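(* Let $\mathcal{A}$ be a finite alphabet and let $\mathbf{p}$ be an irreducible pair on $\mathcal{A}$ which is (piece-wise order reversing and) of Type $\langle x\rangle$. If $\mathbf{q}$ belongs to the labeled extended Rauzy class of $\mathbf{p}$ and is of Type $\langle y\rangle$, then $x=y$.
   Context: Let $n=\#\mathcal{A}\ge2$. A pair is $\mathbf{p}=(p_0,p_1)$ with $p_0,p_1:\mathcal{A}\to\{1,\dots,n\}$ bijections (row $\varepsilon$ lists $p_\varepsilon^{-1}(1),\dots,p_\varepsilon^{-1}(n)$). Irreducible: $p_0^{-1}\{1,\dots,k\}\ne p_1^{-1}\{1,\dots,k\}$ for $1\le k<n$. Rauzy move of type $\varepsilon$: $\varepsilon\mathbf{p}=(p'_0,p'_1)$, $p'_\varepsilon=p_\varepsilon$, and for $z=p_\varepsilon^{-1}(n)$, $p'_{1-\varepsilon}(b)=p_{1-\varepsilon}(b)$ if $p_{1-\varepsilon}(b)\le p_{1-\varepsilon}(z)$, $=p_{1-\varepsilon}(b)+1$ if $p_{1-\varepsilon}(z)<p_{1-\varepsilon}(b)<n$, $=p_{1-\varepsilon}(z)+1$ if $p_{1-\varepsilon}(b)=n$. Left Rauzy move of type $\varepsilon$: $\tilde\varepsilon\mathbf{p}=(p'_0,p'_1)$, $p'_\varepsilon=p_\varepsilon$, and for $a=p_\varepsilon^{-1}(1)$, $p'_{1-\varepsilon}(b)=p_{1-\varepsilon}(a)-1$ if $p_{1-\varepsilon}(b)=1$, $=p_{1-\varepsilon}(b)-1$ if $1<p_{1-\varepsilon}(b)<p_{1-\varepsilon}(a)$,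 unchanged otherwise. The labeled extended Rauzy class of $\mathbf{p}$ is the set of pairs reachable from $\mathbf{p}$ by Rauzy and left Rauzy moves of both types. Standard: $p_0^{-1}(1)=p_1^{-1}(n)$, $p_1^{-1}(1)=p_0^{-1}(n)$. A standard pair is piece-wise order reversing if there are $2=k_0<\dots<k_\ell=n$ with $B_i=p_0^{-1}\{k_{i-1},\dots,k_i-1\}=p_1^{-1}\{k_{i-1},\dots,k_i-1\}$ and $p_0(b)+p_1(b)=k_{i-1}+k_i-1$ for $b\in B_i$; the $B_i$ are blocks ($k$-block: $k$ letters). Chains: with the $1$-blocks $S_1,\dots,S_{k-1}$ listed left to right, chain $C_i$ is the possibly empty sequence of consecutive blocks strictly between $S_{i-1}$ and $S_i$ ($C_1$ before $S_1$, $C_k$ after $S_{k-1}$). Only piece-wise order reversing pairs can have a Type. Types: $\langle1\rangle$: at most one nonempty chain, consisting (if present) of one block. Types $\langle2\rangle$–$\langle5\rangle$ require more than one block of size $\ge2$, and: $\langle2\rangle$: all nonempty chains consist of $2$-blocks; $\langle3\rangle$: each nonempty chain is (i) $m$ $2$-blocks, a $3$-block, $\ell$ $2$-blocks ($m,\ell\ge0$) or (ii) $m\ge1$ $2$-blocks, with at least one chain of form (i); $\langle4\rangle$: exactly one chain is a $4$-block followed by $m\ge0$ $2$-blocks, other nonempty chains consist of $2$-blocks; $\langle5\rangle$: exactly one chain is a single $5$-block, every other nonempty chain is exactly one $2$-block. *)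

(* Defs.v *)
From mathcomp Require Import all_boot.
Set Implicit Arguments. Unset Strict Implicit. Unset Printing Implicit Defensive.

Section Rauzy.
Variable A : finType.
Local Notation n := #|A|.

(* A pair p = (p_0, p_1); positions are 1-based natural numbers in {1..n}.
   Row false = row 0, row true = row 1. *)
Definition pairT := ({ffun A -> nat} * {ffun A -> nat})%type.

Definition row (e : bool) (p : pairT) : {ffun A -> nat} := if e then p.2 else p.1.

Definition is_pos_bij (f : {ffun A -> nat}) : Prop :=
  injective f /\ (forall a, 1 <= f a <= n).

Definition is_pair (p : pairT) : Prop := is_pos_bij p.1 /\ is_pos_bij p.2.

Definition irreducible (p : pairT) : Prop :=
  forall k, 1 <= k < n -> [set a | p.1 a <= k] != [set a | p.2 a <= k].

(* the row 1-e after a (right) Rauzy move of type e; pe = p_e, po = p_{1-e} *)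
Definition rauzy_row (pe po : {ffun A -> nat}) : {ffun A -> nat} :=
  match [pick z | pe z == n] with
  | Some z => [ffun b => if po b <= po z then po b
                         else if po b < n then (po b).+1
                         else (po z).+1]
  | None => po
  end.

Definition lrauzy_row (pe po : {ffun A -> nat}) : {ffun A -> nat} :=
  match [pick a | pe a == 1] with
  | Some a => [ffun b => if po b == 1 then (po a).-1
                         else if (1 < po b) && (po b < po a) then (po b).-1
                         else po b]
  | None => po
  end.

Definition rauzy (e : bool) (p : pairT) : pairT :=
  if e then (rauzy_row p.2 p.1, p.2) else (p.1, rauzy_row p.1 p.2).

Definition lrauzy (e : bool) (p : pairT) : pairT :=
  if e then (lrauzy_row p.2 p.1, p.2) else (p.1, lrauzy_row p.1 p.2).

Inductive ext_class (p : pairT) : pairT -> Prop :=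
  | ec_refl : ext_class p p
  | ec_rauzy q e : ext_class p q -> ext_class p (rauzy e q)
  | ec_lrauzy q e : ext_class p q -> ext_class p (lrauzy e q).

Definition standard (p : pairT) : Prop :=
  forall a, (p.1 a == 1) = (p.2 a == n) /\ (p.2 a == 1) = (p.1 a == n).

Definition pwor_witness (p : pairT) (ks : seq nat) : Prop :=
  [/\ ks != [::], head 0 ks = 2, last 0 ks = n, sorted ltn ks &
   forall i, i.+1 < size ks ->
     let u := nth 0 ks i in let v := nth 0 ks i.+1 in
     forall b, (u <= p.1 b < v) = (u <= p.2 b < v) /\
               (u <= p.1 b < v -> p.1 b + p.2 b = u + v - 1)].

Definition piecewise_order_reversing (p : pairT) : Prop :=
  standard p /\ exists ks, pwor_witness p ks.
End Rauzy.

Definition block_sizes (ks : seq nat) : seq nat :=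
  [seq nth 0 ks i.+1 - nth 0 ks i | i <- iota 0 (size ks).-1].

(* chains C_1, ..., C_k (block sizes), separated by the 1-blocks *)
Fixpoint chains (s : seq nat) : seq (seq nat) :=
  match s with
  | [::] => [:: [::]]
  | x :: s' =>
      let cs := chains s' in
      if x == 1 then [::] :: cs
      else match cs with
           | c :: cs' => (x :: c) :: cs'
           | [::] => [:: [:: x]]
           end
  end.

Definition nonempty_chains (cs : seq (seq nat)) := [seq c <- cs | c != [::]].

Definition many_big_blocks (s : seq nat) : Prop := 1 < count (fun x => 2 <= x) s.

Definition chain_form_i (c : seq nat) : Prop :=
  exists m l, c = nseq m 2 ++ 3 :: nseq l 2.
Definition chain_form_ii (c : seq nat) : Prop :=
  exists m, 1 <= m /\ c = nseq m 2.

Definition type_cond (x : nat) (s : seq nat) : Prop :=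
  let cs := chains s in
  let ne := nonempty_chains cs in
  match x with
  | 1 => size ne <= 1 /\ (forall c, c \in ne -> size c = 1)
  | 2 => many_big_blocks s /\ (forall c, c \in ne -> all (fun y => y == 2) c)
  | 3 => many_big_blocks s /\
         (forall c, c \in ne -> chain_form_i c \/ chain_form_ii c) /\
         (exists2 c, c \in ne & chain_form_i c)
  | 4 => many_big_blocks s /\
         exists i, [/\ i < size cs,
                       (exists m, nth [::] cs i = 4 :: nseq m 2) &
                       forall j, j < size cs -> j <> i ->
                         all (fun y => y == 2) (nth [::] cs j)]
  | 5 => many_big_blocks s /\
         exists i, [/\ i < size cs, nth [::] cs i = [:: 5] &
                       forall j, j < size cs -> j <> i ->
                         nth [::] cs j = [::] \/ nth [::] cs j = [:: 2]]
  | _ => False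
  end.

Definition has_type (A : finType) (x : nat) (p : pairT A) : Prop :=
  standard p /\ exists ks, pwor_witness p ks /\ type_cond x (block_sizes ks).

(* Main.v *)
Require Import Defs.
From mathcomp Require Import all_boot all_order all_algebra zify ring.
Set Implicit Arguments. Unset Strict Implicit. Unset Printing Implicit Defensive.
Import GRing.Theory Num.Theory.

(* Three invariants of Rauzy moves separate the types. Call two letters crossing
   when the two rows order them differently. A move with winner z and loser w
   adds, modulo 2, row z of the crossing matrix to row w. Hence
   (1) realizability of the crossing graph by 2-element sets meeting in an odd
   number of points (hyperellipticity) is invariant; it holds for Type 1 and fails
   as soon as two blocks have size at least 2;
   (2) the Gauss sum of the quadratic form with value 1 on letters and polar form
   the crossing matrix (the spin parity) is invariant; up to the factor -2 it is a
   product over blocks, positive for Type 2, zero for Type 3, negative for Types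
   4 and 5;
   (3) the number of singularities of angle 2 pi is invariant; for a piece-wise
   order reversing pair it is the number of empty chains. With #A and the Gauss sum
   it separates Type 4 from Type 5, as Type 4 has more empty chains.
   The crossing graph keeps having no isolated vertex along the moves, which forces
   winner and loser to differ. *)

(** * Gauss sums of graphs *)

Section CrossingGraph.
Variable A : finType.
Implicit Types (c : rel A) (m : pred A) (u v B R : {set A}).
Local Open Scope ring_scope.

Definition sgn (b : bool) : int := (-1) ^+ b.

Lemma sgnD a b : sgn (a (+) b) = sgn a * sgn b.
Proof. by case: a; case: b. Qed.

Lemma sgn_sqr b : sgn b * sgn b = 1.
Proof. by case: b. Qed.

Definition chi c x v := \prod_(y in v) sgn (c x y).

(** This is (-1) to the power q(v), where q is the quadratic form over the field with two elements
    that has values [m] on letters and polar form [c]; a subset stands for the sum of its letters.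
    Comparing ranks counts each unordered pair once. *)
Definition wt c m v : int :=
  (\prod_(x in v) sgn (m x)) *
  \prod_(x in v) \prod_(y in v) sgn ((enum_rank x < enum_rank y)%N && c x y).

Definition gauss c m B := \sum_(v : {set A} | v \subset B) wt c m v.

Lemma chiU1 c x y v : y \notin v -> chi c x (y |: v) = sgn (c x y) * chi c x v.
Proof. exact: big_setU1. Qed.

Lemma chi_sqr c x v : chi c x v * chi c x v = 1.
Proof. by rewrite -big_split big1 //= => y _; rewrite sgn_sqr. Qed.

(** The rule q(x + v) = q(x) + q(v) + c(x, v), in multiplicative form. *)
Lemma wtU1 c m x v : symmetric c -> x \notin v ->
  wt c m (x |: v) = sgn (m x) * chi c x v * wt c m v.
Proof.
move=> symc xv; rewrite /wt !big_setU1 //= ltnn mul1r.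
under [X in _ * (_ * X) = _]eq_bigr => y _.
  rewrite big_setU1 //=; over.
rewrite big_split /=.
have -> : chi c x v =
  (\prod_(i in v) sgn ((enum_rank x < enum_rank i)%N && c x i)) *
  \prod_(i in v) sgn ((enum_rank i < enum_rank x)%N && c i x).
  rewrite -big_split; apply: eq_bigr => y yv /=.
  have nxy : enum_rank x != enum_rank y :> nat.
    by apply: contraNneq xv => /ord_inj/enum_rank_inj->.
  by rewrite [c y x]symc; case: ltngtP nxy; rewrite ?mul1r ?mulr1.
ring.
Qed.

Lemma gaussU1 c m x B : x \notin B ->
  gauss c m (x |: B) =
  \sum_(v : {set A} | v \subset B) (wt c m v + wt c m (x |: v)).
Proof.
move=> xB; rewrite big_split /= /gauss (bigID (fun v => x \in v)) /= addrC.
have notinx v : v \subset B -> x \notin v.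
  by move=> vB; apply: contra xB; apply: (subsetP vB).
congr (_ + _).
  apply: eq_bigl => v; apply/andP/idP => [[vxB xv]|vB].
    apply/subsetP => y yv; have := subsetP vxB y yv.
    by rewrite !inE; case: eqP yv xv => // -> ->.
  by split; [apply: subset_trans vB (subsetUr _ _) | exact: notinx].
rewrite (reindex_onto (fun v => x |: v) (fun v => v :\ x)) /=; last first.
  by move=> v /andP[_ xv]; rewrite setD1K.
apply: eq_bigl => v; apply/idP/idP => [|vB].
  case/andP=> /andP[vxB _] /eqP <-; apply/subsetP => y.
  rewrite !inE => /andP[/negbTE yx]; rewrite yx /= => yv.
  by have := subsetP vxB y; rewrite !inE yx yv => /(_ isT).
by rewrite setU1K ?notinx // eqxx setU11 setUS.
Qed.

(* Completing the square along the hyperbolic plane spanned by b and d. *)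
Lemma gauss_twins c m b d B : symmetric c -> b \notin d |: B -> d \notin B ->
  c b d -> m b = m d -> {in B, c b =1 c d} ->
  gauss c m (b |: (d |: B)) =
  2 * sgn (m b) * gauss c (fun y => m y (+) c b y) B.
Proof.
move=> symc bB dB cbd mbd tw.
have nin (x : A) (X v : {set A}) : v \subset X -> x \notin X -> x \notin v.
  by move=> vX; apply: contra; apply: (subsetP vX).
rewrite gaussU1 // big_split /= -/(gauss _ _ _) gaussU1 //.
(* Adjoining [b] is absorbed into the letter values, which become [m y (+) c b y]. *)
have -> : \sum_(v : {set A} | v \subset d |: B) wt c m (b |: v) =
   gauss c (fun y => m y (+) c b y) (d |: B) * sgn (m b).
  rewrite /gauss mulr_suml; apply: eq_bigr => v vB.
  rewrite wtU1 ?(nin _ _ _ vB) // /wt /chi.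
  under [in RHS]eq_bigr => y _ do rewrite sgnD.
  rewrite big_split /=; ring.
rewrite gaussU1 // mulr_suml -big_split /= /gauss mulr_sumr.
apply: eq_bigr => v vB.
have dv := nin _ _ _ vB dB.
rewrite !wtU1 // cbd -mbd.
have -> : chi c d v = chi c b v.
  by apply: eq_bigr => y yv; rewrite tw // (subsetP vB).
have -> : wt c (fun y => m y (+) c b y) v = chi c b v * wt c m v.
  rewrite /wt /chi; under eq_bigr => y _ do rewrite sgnD.
  rewrite big_split /=; ring.
have := chi_sqr c b v; set X := chi c b v => XX.
rewrite !sgnD; have -> : sgn true = -1 by [].
have ss := sgn_sqr (m b); move: ss; set s := sgn (m b) => ss.
(* The four terms adjoin to [v] nothing, [d], [b], and both. The minus sign comes from [c b d]; it
   makes the last term cancel the first. *)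
transitivity (wt c m v * (1 + s * X + X * s - (s * s) * (X * X))); first ring.
rewrite ss XX; ring.
Qed.

Lemma eq_gauss c m m' B : {in B, m =1 m'} -> gauss c m B = gauss c m' B.
Proof.
move=> mm; apply: eq_bigr => v vB; rewrite /wt; congr (_ * _).
by apply: eq_bigr => x xv; rewrite mm // (subsetP vB).
Qed.

Lemma gauss_isolated c m x B : symmetric c -> x \notin B ->
  {in B, forall y, c x y = false} ->
  gauss c m (x |: B) = (1 + sgn (m x)) * gauss c m B.
Proof.
move=> symc xB iso; rewrite gaussU1 // /gauss mulr_sumr; apply: eq_bigr => v vB.
rewrite wtU1 //; last by apply: contra xB; apply: (subsetP vB).
rewrite /chi big1 => [|y yv]; first by ring.
by rewrite iso // (subsetP vB).
Qed.

(** The Gauss sum of a complete graph on [k] letters of common value [b]. Two of its letters are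
    twins in the sense of [gauss_twins], and splitting them off flips the value of the others. For
    [b = false] the sizes 1 to 5 give 2, 2, 0, -4, -8. *)
Fixpoint clique_gauss (b : bool) k : int :=
  match k with
  | 0 => 1
  | 1 => 1 + sgn b
  | k'.+2 => 2 * sgn b * clique_gauss (~~ b) k'
  end.

Lemma gauss_clique c m b B R : symmetric c -> [disjoint B & R] ->
  {in B, forall x, m x = b} ->
  {in B &, forall x y, x != y -> c x y} ->
  {in B & R, forall x y, c x y = false} ->
  gauss c m (B :|: R) = clique_gauss b #|B| * gauss c m R.
Proof.
move=> symc; move cB : #|B| => k.
elim/ltn_ind: k m b B cB => [[|[|k]]] IH m b B cB disj mB clB isoB.
- by rewrite (cards0_eq cB) set0U mul1r.
- have /cards1P[x Bx] := introT eqP cB; subst B.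
  rewrite gauss_isolated //= ?mB ?inE //.
    by rewrite -disjoints1.
  by move=> y yR; apply: isoB; rewrite ?inE.
have [x xB] : exists x, x \in B by apply/set0Pn; rewrite -card_gt0 cB.
have [y yB] : exists y, y \in B :\ x.
  by apply/set0Pn; rewrite -card_gt0; have := cardsD1 x B; rewrite xB cB; lia.
set C := B :\ x :\ y.
have cC : #|C| = k.
  have := cardsD1 x B; have := cardsD1 y (B :\ x); rewrite xB yB cB -/C; lia.
have BE : B = x |: (y |: C) by rewrite setD1K // setD1K.
have sCB : C \subset B by rewrite BE; apply/subsetP=> t; rewrite !inE => ->; rewrite !orbT.
move: (yB); rewrite !inE => /andP[yx yB'].
have nR t : t \in B -> t \notin R by move=> tB; apply/negP=> tR; move/pred0P: disj => /(_ t) /=; rewrite tB tR.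
have xCR : x \notin y |: (C :|: R) by rewrite !inE eqxx eq_sym (negbTE yx) (negbTE (nR _ xB)) ?andbF.
have yCR : y \notin C :|: R by rewrite !inE eqxx (negbTE (nR _ yB')).
rewrite {1}BE -!setUA gauss_twins //.
- rewrite (IH k _ _ (~~ b) C) //=.
  + rewrite (@eq_gauss _ (fun t => m t (+) c x t) m) ?mB //; last by move=> t tR; rewrite /= isoB // addbF.
    by rewrite mulrA.
  + by apply: disjointWl sCB disj.
  + move=> t tC; have tB := subsetP sCB _ tC; rewrite mB // clB ?addbT //.
    by rewrite eq_sym; move: tC; rewrite !inE => /and3P[].
  + by move=> t t' tC t'C; apply: clB; exact: (subsetP sCB).
  + by move=> t t' tC t'R; apply: isoB => //; exact: (subsetP sCB).
- by rewrite clB // eq_sym.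
- by rewrite !mB.
move=> t; rewrite inE => /orP[tC|tR]; last by rewrite !isoB.
have tB := subsetP sCB _ tC; move: tC; rewrite !inE => /and3P[ty tx _].
by rewrite !clB // eq_sym.
Qed.

(* The effect of a Rauzy move on the crossing graph: the transvection along
   the winner z is applied to the loser w. *)
Definition slide z w c c' :=
  [/\ c z w, forall x y, x != w -> y != w -> c' x y = c x y
    & forall b, b != w -> c' w b = c w b (+) c z b].

(** A transvection over the field with two elements is its own inverse. *)
Lemma slide_sym z w c c' : symmetric c -> irreflexive c -> symmetric c' ->
  slide z w c c' -> slide z w c' c.
Proof.
move=> symc irc symc' [czw out inw].
have nzw : z != w by apply: contraTneq czw => ->; rewrite irc.
split=> [|x y xw yw|b bw]; first by rewrite symc' inw // irc symc czw.
  by rewrite out.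
by rewrite inw // out // -addbA addbb addbF.
Qed.

(** A slide is the base change replacing w by w + z, so the sum is only reindexed. The new letter
    again has value 1, because q(w + z) = 1 + 1 + c(z, w) = 1. *)
Lemma gauss_slide z w c c' : symmetric c -> irreflexive c -> symmetric c' ->
  slide z w c c' -> gauss c' predT setT = gauss c predT setT.
Proof.
move=> symc irc symc' [czw out inw].
have nzw : z != w by apply: contraTneq czw => ->; rewrite irc.
(* The base change on subsets: toggle [z] whenever [w] is present. *)
pose T v := if w \in v then (if z \in v then v :\ z else z |: v) else v.
have TK : involutive T.
  move=> v; rewrite /T; case: (boolP (w \in v)) => wv; last by rewrite (negbTE wv).
  case: (boolP (z \in v)) => zv.
    by rewrite !inE eq_sym nzw wv eqxx /= setD1K.
  by rewrite !inE wv orbT eqxx /= setU1K.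
have wtout v : w \notin v -> wt c' predT v = wt c predT v.
  move=> wv; rewrite /wt; congr (_ * _); apply: eq_bigr => x xv.
  apply: eq_bigr => y yv; rewrite out //.
    by apply: contraNneq wv => <-.
  by apply: contraNneq wv => <-.
have chiw u : w \notin u -> chi c' w u = chi c w u * chi c z u.
  move=> wu; rewrite /chi -big_split; apply: eq_bigr => y yu /=.
  by rewrite inw ?sgnD //; apply: contraNneq wu => <-.
have key u : w \notin u -> z \notin u ->
   wt c' predT (w |: u) = wt c predT (z |: (w |: u)) /\
   wt c' predT (z |: (w |: u)) = wt c predT (w |: u).
  move=> wu zu.
  have zwu : z \notin w |: u by rewrite !inE negb_or nzw.
  rewrite !wtU1 // !chiU1 // wtout // chiw // [c' z w]symc' inw // irc addbF [c w z]symc czw.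
  have -> : chi c' z u = chi c z u.
    by apply: eq_bigr => y yu; rewrite out //; apply: contraNneq wu => <-.
  have := chi_sqr c z u; have -> : sgn true = -1 by [].
  set X := chi c z u; set Y := chi c w u => XX; split; first by ring.
  transitivity (- 1 * Y * wt c predT u * (X * X)); first by ring.
  by rewrite XX; ring.
rewrite /gauss (reindex_inj (inv_inj TK)).
apply: eq_big => [v|v _]; first by rewrite !subsetT.
rewrite /T; case: (boolP (w \in v)) => wv; last by rewrite wtout.
case: (boolP (z \in v)) => zv.
  have [] := key (v :\ z :\ w); rewrite ?inE ?eqxx ?andbF //.
  have wvz : w \in v :\ z by rewrite !inE eq_sym nzw.
  by rewrite setD1K // setD1K.
have [] := key (v :\ w); rewrite ?inE ?eqxx ?(negbTE zv) ?andbF //.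
by rewrite setD1K.
Qed.
End CrossingGraph.

(** * Crossing graphs realized by 2-element sets *)

Section TwoSubsets.
Variable T : finType.
Implicit Types X Y Z : {set T}.

Definition symdiff X Y := (X :\: Y) :|: (Y :\: X).

Lemma card_symdiff X Y : #|symdiff X Y| + 2 * #|X :&: Y| = #|X| + #|Y|.
Proof.
rewrite cardsU; have -> : (X :\: Y) :&: (Y :\: X) = set0.
  by apply/setP => t; rewrite !inE; case: (t \in X); case: (t \in Y).
have := cardsID Y X; have := cardsID X Y; rewrite cards0 (setIC Y X); lia.
Qed.

Lemma odd_symdiffI X Y Z :
  odd #|symdiff X Y :&: Z| = odd #|X :&: Z| (+) odd #|Y :&: Z|.
Proof.
have -> : symdiff X Y :&: Z = symdiff (X :&: Z) (Y :&: Z).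
  by apply/setP => t; rewrite !inE; case: (t \in X); case: (t \in Y); case: (t \in Z).
have := card_symdiff (X :&: Z) (Y :&: Z); lia.
Qed.

Lemma odd_cardI2 X s t : s != t ->
  odd #|X :&: [set s; t]| = (s \in X) (+) (t \in X).
Proof.
move=> st; have -> : X :&: [set s; t] = 
   (if s \in X then [set s] else set0) :|: (if t \in X then [set t] else set0).
  apply/setP => r; rewrite !inE.
  case: (boolP (s \in X)) => sX; case: (boolP (t \in X)) => tX; rewrite !inE ?orbF ?orbT;
   case: (r =P s) => [->|_] /=; rewrite ?(negbTE st) ?sX ?(negbTE sX) ?andbF //;
   by case: (r =P t) => [->|_]; rewrite ?tX ?(negbTE tX) ?andbF.
case: (s \in X); case: (t \in X); rewrite ?setU0 ?set0U ?cards1 ?cards0 //.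
by rewrite cards2 st.
Qed.

Lemma card2_contains X s t : #|X| = 2 -> s != t -> s \in X -> t \in X -> X = [set s; t].
Proof.
move=> cX st sX tX; apply/esym/eqP; rewrite eqEcard cards2 st cX leqnn andbT.
by apply/subsetP => r; rewrite !inE => /orP[]/eqP->.
Qed.

(* The 2-subsets P, Q, X, Y pairwise meet in one point, hence form a star, and so
   do P, Q, X', Y'; the two stars share their centre and so cannot be orthogonal. *)
Lemma no_two_stars (P Q X Y X' Y' : {set T}) :
  #|P| = 2 -> #|Q| = 2 -> #|X| = 2 -> #|Y| = 2 -> #|X'| = 2 -> #|Y'| = 2 ->
  odd #|P :&: Q| ->
  odd #|X :&: P| -> odd #|X :&: Q| -> odd #|Y :&: P| -> odd #|Y :&: Q| -> odd #|X :&: Y| ->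
  odd #|X' :&: P| -> odd #|X' :&: Q| -> odd #|Y' :&: P| -> odd #|Y' :&: Q| -> odd #|X' :&: Y'| ->
  odd #|X' :&: X| = false -> odd #|Y' :&: X| = false -> False.
Proof.
move=> cP cQ cX cY cX' cY' PQ.
have [o oP oQ] : exists2 o, o \in P & o \in Q.
  have /set0Pn[o] : P :&: Q != set0 by rewrite -card_gt0; lia.
  by rewrite inE => /andP[]; exists o.
have other Z : #|Z| = 2 -> o \in Z -> exists2 s, o != s & Z = [set o; s].
  move=> /eqP /cards2P[s [t [st ->]]]; rewrite !inE => /orP[]/eqP->.
    by exists t.
  by exists s; rewrite 1?eq_sym // setUC.
have [p op PE] := other P cP oP; have [q oq QE] := other Q cQ oQ; subst P Q.
have pq : p != q.
  by apply: contraTneq PQ => ->; rewrite setIid cards2 oq.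
rewrite !odd_cardI2 //.
(* If [o] were not in [Z], then Z = {p, q}; but a set meeting both {o, p} and {o, q} oddly meets {p,
   q} evenly. *)
have centre (Z W : {set T}) : #|Z| = 2 -> #|W| = 2 -> (o \in Z) (+) (p \in Z) ->
    (o \in Z) (+) (q \in Z) -> (o \in W) (+) (p \in W) -> (o \in W) (+) (q \in W) ->
    odd #|Z :&: W| -> o \in Z.
  move=> cZ cW; case: (boolP (o \in Z)) => //= oZ pZ qZ.
  rewrite setIC (card2_contains cZ pq pZ qZ) odd_cardI2 //.
  by case: (o \in W); case: (p \in W); case: (q \in W).
move=> X1 X2 Y1 Y2 XY X'1 X'2 Y'1 Y'2 XY' XX' XY''.
have oX := centre _ _ cX cY X1 X2 Y1 Y2 XY.
have oX' := centre _ _ cX' cY' X'1 X'2 Y'1 Y'2 XY'.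
have oY' : o \in Y' by apply: (centre _ _ cY' cX' Y'1 Y'2 X'1 X'2); rewrite setIC.
(* With X = {o, r}, even intersections force [r] into [X'] and [Y'], so both equal {o, r} and meet
   in two points. *)
have [r or XE] := other X cX oX; subst X.
move: XX' XY''; rewrite !odd_cardI2 // oX' oY' /= => /negbFE rX' /negbFE rY'.
move: XY'; rewrite (card2_contains cX' or oX' rX') (card2_contains cY' or oY' rY').
by rewrite setIid cards2 or.
Qed.
End TwoSubsets.

(** * Graph properties preserved by slides *)

Section SlideInvariants.
Variable A : finType.
Implicit Types c : rel A.

(* Modulo 2 and up to the radical, this says that the letters are roots of a
   root system of type A, which is the hyperelliptic case. *)
Definition line_graph c := exists phi : A -> {set option A},
  (forall x, #|phi x| = 2) /\
  forall x y, x != y -> c x y = odd #|phi x :&: phi y|.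

(** Replace the set of [w] by its symmetric difference with the set of [z]. As [c z w] holds, the
    two sets share exactly one point, so the result has two elements again. *)
Lemma line_graph_slide z w c c' : symmetric c -> irreflexive c -> symmetric c' ->
  slide z w c c' -> line_graph c -> line_graph c'.
Proof.
move=> symc irc symc' [czw out inw] [phi [cphi phiE]].
have nzw : z != w by apply: contraTneq czw => ->; rewrite irc.
pose psi x := if x == w then symdiff (phi w) (phi z) else phi x.
have psiw b : b != w -> c' w b = odd #|psi w :&: psi b|.
  move=> bw; rewrite /psi eqxx (negbTE bw) odd_symdiffI inw // phiE 1?eq_sym //.
  case: (eqVneq z b) => [<-|zb]; last by rewrite -(phiE z b).
  by rewrite irc setIid cphi.
exists psi; split=> [x|x y xy].
  rewrite /psi; case: eqP => // _.
  have := card_symdiff (phi w) (phi z); rewrite !cphi.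
  have : odd #|phi w :&: phi z| by rewrite -phiE 1?eq_sym // symc.
  have := subset_leq_card (subsetIl (phi w) (phi z)); rewrite cphi; lia.
case: (eqVneq x w) xy => [-> wy|xw xy]; first by apply: psiw; rewrite eq_sym.
case: (eqVneq y w) => [->|yw]; first by rewrite symc' psiw // setIC.
by rewrite out // /psi (negbTE xw) (negbTE yw) phiE.
Qed.

Definition no_isolated c := forall x, exists2 y, x != y & c x y.

(** If the slide removes the edge from [x] to [w], then [x] is adjacent to [z], and that edge
    stays. *)
Lemma no_isolated_slide z w c c' : symmetric c -> irreflexive c -> symmetric c' ->
  slide z w c c' -> no_isolated c -> no_isolated c'.
Proof.
move=> symc irc symc' [czw out inw] iso x.
have nzw : z != w by apply: contraTneq czw => ->; rewrite irc.
case: (eqVneq x w) => [->|xw].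
  by exists z; rewrite 1?eq_sym // inw // irc addbF symc.
have [y xy cxy] := iso x.
case: (eqVneq y w) => [yw|yw]; last by exists y; rewrite // out.
subst y; case: (boolP (c z x)) => czx; last first.
  by exists w => //; rewrite symc' inw // symc cxy (negbTE czx).
exists z; last by rewrite out // symc.
by apply: contraTneq czx => ->; rewrite irc.
Qed.
End SlideInvariants.

(** * Rauzy moves *)

Section Moves.
Variable A : finType.
Local Notation n := #|A|.
Implicit Types (p : pairT A) (f g : {ffun A -> nat}).

Definition cross p : rel A := fun x y => (p.1 x < p.1 y) (+) (p.2 x < p.2 y).

Lemma crossE f g x y : cross (f, g) x y = (f x < f y) (+) (g x < g y).
Proof. by []. Qed.

Lemma cross_irr p : irreflexive (cross p).
Proof. by move=> x; rewrite /cross !ltnn. Qed.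

Lemma cross_sym p : is_pair p -> symmetric (cross p).
Proof.
move=> [[if0 _] [ig0 _]] x y; rewrite /cross; case: (eqVneq x y) => [->//|xy].
have : p.1 x != p.1 y by rewrite (inj_eq if0).
have : p.2 x != p.2 y by rewrite (inj_eq ig0).
by lia.
Qed.

Lemma pos_surj f t : is_pos_bij f -> 1 <= t <= n -> exists x, f x = t.
Proof.
move=> [injf bf] /andP[t1 tn].
have h_lt x : (f x).-1 < n by have := bf x; lia.
pose h x := Ordinal (h_lt x).
have injh : injective h.
  by move=> x y /(congr1 val) /= E; apply: injf; have := bf x; have := bf y; lia.
have tn' : t.-1 < n by lia.
have /codomP[x hx] : Ordinal tn' \in codom h.
  by apply: inj_card_onto => //; rewrite card_ord.
by exists x; move/(congr1 val): hx => /=; have := bf x; lia.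
Qed.

Definition adj f : rel A := fun x y => f y == (f x).+1.

(* Number of singularities of angle 2 pi, for l, l' the last and a, a' the first
   letters of the rows f, g: the last three summands account for the
   singularities met by the end points of the interval. *)
Definition marked f g (l l' a a' : A) : nat :=
  #|[set u : A * A | adj f u.1 u.2 && adj g u.1 u.2]|
  + [exists x, adj g l x && adj f l' x]
  + [exists y, adj g y a && adj f y a']
  + (adj g l a && adj f l' a').

(** A relation, since the end letters are obtained by existence; [marked_points_unique] shows that
    it determines [k]. *)
Definition marked_points p k := exists l l' a a',
  [/\ p.1 l = n, p.2 l' = n, p.1 a = 1, p.2 a' = 1 & marked p.1 p.2 l l' a a' = k].

Lemma rauzy_rowE f g z : is_pos_bij f -> f z = n ->
  rauzy_row f g = [ffun b => if g b <= g z then g b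
                             else if g b < n then (g b).+1 else (g z).+1].
Proof.
move=> [injf _] fz; rewrite /rauzy_row; case: pickP => [z' /eqP fz'|/(_ z)].
  by have -> : z' = z by apply: injf; rewrite fz'.
by rewrite fz eqxx.
Qed.

(** What one move must satisfy for all invariants to pass along the class. The notion is stable
    under row exchange and reflection, so only one of the four moves is analysed directly. *)
Definition good_move p p' :=
  [/\ is_pair p', exists z w, slide z w (cross p) (cross p')
    & forall k, marked_points p k -> marked_points p' k].

(** A letter that is last in both rows crosses no letter. *)
Lemma no_isolated_last p z w : is_pair p -> no_isolated (cross p) ->
  p.1 z = n -> p.2 w = n -> z != w.
Proof.
move=> [[if0 bf] [ig0 bg]] iso fz gw; apply/eqP => zw; subst w.
have [y zy] := iso z; rewrite /cross fz gw.
by have := bf y; have := bg y; lia.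
Qed.

Lemma rauzy_row_pos f g z : is_pos_bij f -> is_pos_bij g -> f z = n ->
  is_pos_bij (rauzy_row f g).
Proof.
move=> Hf [ig bg] fz; rewrite (rauzy_rowE g Hf fz); split=> [x y|x]; last first.
  by rewrite ffunE; have := bg x; have := bg z; case: ifP => ?; [|case: ifP => ?]; lia.
rewrite !ffunE => E; apply: ig; have := bg x; have := bg y; have := bg z.
by move: E; do !case: ifP => ?; lia.
Qed.

(** As [z] is last in [f], it crosses exactly the letters that follow it in [g]. Moving [w] from the
    end of [g] to just after [z] toggles the crossings of [w] with exactly these letters. *)
Lemma rauzy_slide f g z w : is_pos_bij f -> is_pos_bij g -> f z = n -> g w = n -> z != w ->
  slide z w (cross (f, g)) (cross (f, rauzy_row f g)).
Proof.
move=> Hf Hg fz gw zw; rewrite (rauzy_rowE g Hf fz).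
have [[jf bf] [jg bg]] := (Hf, Hg).
have fneq x y : x != y -> f x != f y by move=> ?; rewrite (inj_eq jf).
have gneq x y : x != y -> g x != g y by move=> ?; rewrite (inj_eq jg).
split=> [|x y xw yw|b bw]; rewrite !crossE ?ffunE ?gw.
- by have := bf w; have := bg z; have := fneq _ _ zw; have := gneq _ _ zw; lia.
- have := gneq _ _ xw; have := gneq _ _ yw; have := bg x; have := bg y; rewrite gw.
  by do !case: ifP => ?; lia.
have := gneq _ _ bw; have := gneq _ _ zw; have := bg b; have := bg z; have := bf b.
rewrite gw fz; case: (eqVneq b z) => [->|bz]; first by rewrite fz; do !case: ifP => ?; lia.
have := gneq _ _ bz; have := fneq _ _ bz; rewrite fz.
by do !case: ifP => ?; lia.
Qed.

(** Let [y] follow [l] and [u] precede [l'] in [g]. The move turns the row .. l y .. u l' into .. l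
    l' y .. u. Nothing follows [l] in [f], so the first two summands of [marked] merely exchange the
    contributions of (u, l') and (l', y). The last two exchange theirs if a = l' or a = y, and are
    unchanged otherwise. *)
Lemma rauzy_marked f g l l' a a' : is_pos_bij f -> is_pos_bij g -> l != l' ->
  f l = n -> g l' = n -> f a = 1 -> g a' = 1 ->
  exists2 u, rauzy_row f g u = n &
    rauzy_row f g a' = 1 /\ marked f (rauzy_row f g) l u a a' = marked f g l l' a a'.
Proof.
move=> Hf Hg ll' fl gl' fa ga'.
have [[jf bf] [jg bg]] := (Hf, Hg).
have ga'l : g a' <= g l by rewrite ga'; have := bg l; lia.
have glN : g l != n by apply: contra ll' => /eqP E; apply/eqP/jg; rewrite E.
have glt : g l < n by have := bg l; lia.
have g'a' : rauzy_row f g a' = 1 by rewrite (rauzy_rowE g Hf fl) ffunE ga'l.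
(* If [l'] already follows [l] in [g], the move is the identity. *)
case: (eqVneq (g l).+1 n) => gl.
  have -> : rauzy_row f g = g.
    apply/ffunP => x; rewrite (rauzy_rowE g Hf fl) ffunE.
    by have := bg x; do !case: ifP => ?; lia.
  by exists l'.
have [u gu] : exists u, g u = n.-1 by apply: pos_surj Hg _; lia.
have [y gy] : exists y, g y = (g l).+1 by apply: pos_surj Hg _; lia.
have gul : u != l by apply/eqP => E; rewrite E in gu; lia.
have yl' : y != l' by apply/eqP => E; rewrite E gl' in gy; lia.
set g' := rauzy_row f g in g'a' *.
have g'E x : g' x = if g x <= g l then g x else if g x < n then (g x).+1 else (g l).+1.
  by rewrite /g' (rauzy_rowE g Hf fl) ffunE.
have g'u : g' u = n.
  rewrite g'E; have : g u != g l by rewrite (inj_eq jg).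
  by do !case: ifP => ?; lia.
exists u => //; split=> //.
have eqg x x' : (x == x') = (g x == g x') by rewrite (inj_eq jg).
have adj'E s t : adj g' s t =
    [|| (s == l) && (t == l'), (s == l') && (t == y) | [&& adj g s t, s != l & t != l']].
  rewrite /adj !g'E !eqg gl' gy; have := bg s; have := bg t.
  by do !case: ifP => ?; lia.
have adjfl t : adj f l t = false by rewrite /adj fl; have := bf t; lia.
have adjgl' t : adj g l' t = false by rewrite /adj gl'; have := bg t; lia.
have adjgl t : adj g l t = (t == y) by rewrite /adj eqg gy.
have adjgr s : adj g s l' = (s == u) by rewrite /adj eqg gu gl'; have := bg s; lia.
have adjgy s : adj g s y = (s == l) by rewrite /adj eqg gy eqSS eq_sym.
have l'l : (l' == l) = false by rewrite eq_sym (negbTE ll').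
have ex1 (P : pred A) (t : A) : [exists x, (x == t) && P x] = P t.
  by apply/existsP/idP => [[x /andP[/eqP->]]|Pt] //; exists t; rewrite eqxx.
rewrite /marked.
have -> : [exists x, adj g' l x && adj f u x] = adj f u l'.
  rewrite -(ex1 (adj f u)); apply: eq_existsb => x; rewrite adj'E eqxx.
  by rewrite [l == l']eq_sym l'l /= andbF !orbF.
have -> : [exists x, adj g l x && adj f l' x] = adj f l' y.
  by rewrite -(ex1 (adj f l')); apply: eq_existsb => x; rewrite adjgl.
set S := [set _ | _]; set S' := [set u : A * A | adj f u.1 u.2 && adj g u.1 u.2].
have SS : S :\ (l', y) = S' :\ (u, l').
  apply/setP => -[s t]; rewrite !inE /= !xpair_eqE adj'E.
  case: (eqVneq s l) => [->|sl] /=; first by rewrite adjfl !andbF.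
  case: (eqVneq s l') => [->|sl'] /=; rewrite ?adjgl' ?andbF /=; first by case: (t == y); rewrite ?andbF.
  case: (eqVneq t l') => [->|tl'] /=; rewrite ?andbF ?andbT ?adjgr ?andbT //=.
  by case: (s == u); rewrite ?andbF.
have c1 := cardsD1 (l', y) S; have c2 := cardsD1 (u, l') S'.
have m1 : ((l', y) \in S) = adj f l' y by rewrite inE /= adj'E !eqxx l'l /= andbT.
have m2 : ((u, l') \in S') = adj f u l' by rewrite inE /= adjgr eqxx andbT.
rewrite m1 SS in c1; rewrite m2 in c2.
rewrite -!addnA.
have -> : [exists x, adj g' x a && adj f x a'] + (adj g' l a && adj f u a') =
          [exists x, adj g x a && adj f x a'] + (adj g l a && adj f l' a').
  case: (eqVneq a l') => [->|al'].
    have -> : [exists x, adj g' x l' && adj f x a'] = false.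
      apply/existsP => -[x]; rewrite adj'E eqxx [l' == y]eq_sym (negbTE yl') /= !andbF !andbT !orbF.
      by case/andP=> /eqP->; rewrite adjfl.
    rewrite adj'E !eqxx adjgl [l' == y]eq_sym (negbTE yl') addn0.
    by congr nat_of_bool; rewrite -(ex1 (fun x => adj f x a')); apply: eq_existsb => x; rewrite adjgr.
  case: (eqVneq a y) => [->|ay].
    have -> : [exists x, adj g x y && adj f x a'] = false.
      apply/existsP => -[x]; rewrite adjgy.
      by case/andP=> /eqP->; rewrite adjfl.
    rewrite adj'E !eqxx adjgl eqxx (negbTE yl') [l == l']eq_sym l'l /= ?andbF /= ?addn0 ?add0n.
    congr nat_of_bool; rewrite -(ex1 (fun x => adj f x a')); apply: eq_existsb => x.
    rewrite adj'E eqxx adjgy (negbTE yl') andbF andbT /=.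
    by case: (eqVneq x l) => [->|]; rewrite ?adjfl ?andbF //= orbF.
  rewrite adj'E adjgl eqxx (negbTE al') (negbTE ay) !andbF !addn0.
  congr nat_of_bool; apply: eq_existsb => x; rewrite adj'E (negbTE al') (negbTE ay) !andbF andbT /=.
  by case: (eqVneq x l) => [->|]; rewrite ?adjfl ?andbF ?andbT.
lia.
Qed.
End Moves.

(** * Row exchange and reflection *)

Section Symmetries.
Variable A : finType.
Local Notation n := #|A|.
Implicit Types (p : pairT A) (f g : {ffun A -> nat}).

Lemma good_rauzy_top p : is_pair p -> no_isolated (cross p) -> 0 < n ->
  good_move p (rauzy false p).
Proof.
case: p => f g /[dup] pp [Hf Hg] iso n0; rewrite /rauzy /=; move: Hf Hg => /= Hf Hg.
have n1n : 1 <= n <= n by rewrite n0 leqnn.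
have [z fz] := pos_surj Hf n1n; have [w gw] := pos_surj Hg n1n.
have zw := no_isolated_last pp iso fz gw.
split.
- by split=> //=; exact: rauzy_row_pos Hf Hg fz.
- by exists z, w; exact: rauzy_slide.
move=> k [l [l' [a [a' /= [fl gl' fa ga' <-]]]]].
have ll' := no_isolated_last pp iso fl gl'.
have [u g'u [g'a' E]] := rauzy_marked Hf Hg ll' fl gl' fa ga'.
by exists l, u, a, a'.
Qed.

Definition swap p : pairT A := (p.2, p.1).
Definition flip_row f : {ffun A -> nat} := [ffun x => n.+1 - f x].
Definition flip p : pairT A := (flip_row p.1, flip_row p.2).

Lemma flip_row_pos f : is_pos_bij f -> is_pos_bij (flip_row f).
Proof.
move=> [jf bf]; split=> [x y|x]; rewrite !ffunE; last by have := bf x; lia.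
by move=> E; apply: jf; have := bf x; have := bf y; lia.
Qed.

Lemma flip_rowK f : is_pos_bij f -> flip_row (flip_row f) = f.
Proof. by move=> [_ bf]; apply/ffunP => x; rewrite !ffunE; have := bf x; lia. Qed.

Lemma flip_pair p : is_pair p -> is_pair (flip p).
Proof. by move=> [H0 H1]; split; exact: flip_row_pos. Qed.

Lemma cross_swap p : cross (swap p) =2 cross p.
Proof. by move=> x y; rewrite /cross addbC. Qed.

Lemma cross_flip p : is_pair p -> cross (flip p) =2 cross p.
Proof.
move=> pp x y; rewrite [RHS](cross_sym pp); move: pp => [[_ bf] [_ bg]].
rewrite /cross !ffunE; have := bf x; have := bf y; have := bg x; have := bg y.
by lia.
Qed.

Lemma adj_flip f x y : is_pos_bij f -> adj (flip_row f) x y = adj f y x.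
Proof. by move=> [_ bf]; rewrite /adj !ffunE; have := bf x; have := bf y; lia. Qed.

Lemma marked_swap p k : marked_points p k -> marked_points (swap p) k.
Proof.
move=> [l [l' [a [a' [fl gl' fa ga' <-]]]]]; exists l', l, a', a; split=> //=.
rewrite /marked; congr (#|pred_of_set _| + _ + _ + _).
- by apply/setP => u; rewrite !inE andbC.
- by congr nat_of_bool; apply: eq_existsb => x; rewrite andbC.
- by congr nat_of_bool; apply: eq_existsb => x; rewrite andbC.
- by rewrite andbC.
Qed.

Lemma marked_flip p k : is_pair p -> marked_points p k -> marked_points (flip p) k.
Proof.
move=> [Hf Hg] [l [l' [a [a' [fl gl' fa ga' <-]]]]]; exists a, a', l, l'.
split; rewrite ?ffunE ?fl ?gl' ?fa ?ga' ?subSS ?subn0 ?subSnn //.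
rewrite /marked /flip /= !adj_flip //.
have -> : [exists x, adj (flip_row p.2) a x && adj (flip_row p.1) a' x] =
          [exists x, adj p.2 x a && adj p.1 x a'].
  by apply: eq_existsb => x; rewrite !adj_flip.
have -> : [exists x, adj (flip_row p.2) x l && adj (flip_row p.1) x l'] =
          [exists x, adj p.2 l x && adj p.1 l' x].
  by apply: eq_existsb => x; rewrite !adj_flip.
have -> : #|[set u : A * A | adj (flip_row p.1) u.1 u.2 && adj (flip_row p.2) u.1 u.2]| =
          #|[set u : A * A | adj p.1 u.1 u.2 && adj p.2 u.1 u.2]|.
  have sw_inj : injective (fun u : A * A => (u.2, u.1)) by move=> [? ?] [? ?] [-> ->].
  rewrite -[RHS](card_imset _ sw_inj); apply: eq_card => -[x y].
  rewrite !inE !adj_flip //=; apply/idP/imsetP => [H|[[s t]]].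
    by exists (y, x); rewrite ?inE.
  by rewrite inE /= => H [-> ->].
by congr (_ + _); exact: addnAC.
Qed.

Lemma eq_no_isolated (c c' : rel A) : c =2 c' -> no_isolated c -> no_isolated c'.
Proof. by move=> E iso x; have [y xy cxy] := iso x; exists y; rewrite -?E. Qed.

Lemma eq_slide z w (c1 c1' c2 c2' : rel A) : c1 =2 c2 -> c1' =2 c2' ->
  slide z w c1 c1' -> slide z w c2 c2'.
Proof.
move=> E E' [czw out inw]; split; first by rewrite -E.
  by move=> x y xw yw; rewrite -E -E' out.
by move=> b bw; rewrite -!E -E' inw.
Qed.

Lemma good_swap p p' : good_move (swap p) (swap p') -> good_move p p'.
Proof.
move=> [[H1 H0] [z [w sl]] mk]; split.
- by split.
- by exists z, w; apply: eq_slide sl; exact: cross_swap.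
case: p p' mk {H1 H0 sl} => [f g] [f' g'] mk k /marked_swap/mk/marked_swap.
by [].
Qed.

Lemma good_flip p p' : is_pair p -> good_move (flip p) p' -> good_move p (flip p').
Proof.
move=> pp [pp' [z [w sl]] mk]; split; first exact: flip_pair.
  exists z, w; apply: eq_slide sl; first exact: cross_flip.
  by move=> x y; rewrite cross_flip.
by move=> k /(marked_flip pp)/mk/(marked_flip pp').
Qed.

Lemma no_isolated_first p z : is_pair p -> no_isolated (cross p) ->
  p.1 z = 1 -> p.2 z = 1 -> False.
Proof.
move=> [[jf bf] [jg bg]] iso fz gz; have [y zy] := iso z.
have : p.1 z != p.1 y by rewrite (inj_eq jf).
have : p.2 z != p.2 y by rewrite (inj_eq jg).
by rewrite /cross fz gz; have := bf y; have := bg y; lia.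
Qed.

(** The last hypothesis excludes [g z = 1], where the predecessor in [lrauzy_row] would give
    position 0. *)
Lemma lrauzy_rowE f g : is_pos_bij f -> is_pos_bij g ->
  (forall z, f z = 1 -> g z = 1 -> False) ->
  lrauzy_row f g = flip_row (rauzy_row (flip_row f) (flip_row g)).
Proof.
move=> Hf Hg first; have [[_ bf] [_ bg]] := (Hf, Hg).
rewrite /lrauzy_row /rauzy_row.
have fE x : (flip_row f x == n) = (f x == 1) by rewrite ffunE; have := bf x; lia.
rewrite (eq_pick fE).
case: pickP => [z /eqP fz|_]; last by rewrite flip_rowK.
apply/ffunP => x; rewrite !ffunE; have := bg x; have := bg z; have := first z fz.
by do !case: ifP => ?; lia.
Qed.

Lemma lrauzyE e p : is_pair p -> no_isolated (cross p) ->
  lrauzy e p = flip (rauzy e (flip p)).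
Proof.
move=> pp iso; have first z := @no_isolated_first p z pp iso.
case: p pp {iso} first => f g [/= Hf Hg] first; rewrite /lrauzy /rauzy; case: e => /=.
  by rewrite lrauzy_rowE // /flip /= ?flip_rowK // => z ? ?; apply: (first z).
by rewrite lrauzy_rowE // /flip /= flip_rowK.
Qed.

Lemma good_rauzy e p : is_pair p -> no_isolated (cross p) -> 0 < n ->
  good_move p (rauzy e p).
Proof.
move=> pp iso n0; case: e; last exact: good_rauzy_top.
apply: good_swap; apply: (@good_rauzy_top (swap p)) => //; first by case: pp.
by apply: eq_no_isolated iso => x y; rewrite cross_swap.
Qed.

Lemma good_lrauzy e p : is_pair p -> no_isolated (cross p) -> 0 < n ->
  good_move p (lrauzy e p).
Proof.
move=> pp iso n0; rewrite lrauzyE //; apply: good_flip => //.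
apply: good_rauzy => //; first exact: flip_pair.
by apply: eq_no_isolated iso => x y; rewrite cross_flip.
Qed.

(** Absence of isolated letters is carried through the induction because it makes the next move
    good. The backward implication for [line_graph] comes from [slide_sym]. *)
Lemma ext_class_invariants p q : is_pair p -> no_isolated (cross p) -> 0 < n ->
  ext_class p q ->
  [/\ is_pair q /\ no_isolated (cross q),
      gauss (cross q) predT setT = gauss (cross p) predT setT,
      line_graph (cross p) -> line_graph (cross q),
      line_graph (cross q) -> line_graph (cross p)
    & forall k, marked_points p k -> marked_points q k].
Proof.
move=> pp isop n0.
have step q0 q1 : good_move q0 q1 ->
  [/\ is_pair q0 /\ no_isolated (cross q0),
      gauss (cross q0) predT setT = gauss (cross p) predT setT,
      line_graph (cross p) -> line_graph (cross q0),
      line_graph (cross q0) -> line_graph (cross p)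
    & forall k, marked_points p k -> marked_points q0 k] ->
  [/\ is_pair q1 /\ no_isolated (cross q1),
      gauss (cross q1) predT setT = gauss (cross p) predT setT,
      line_graph (cross p) -> line_graph (cross q1),
      line_graph (cross q1) -> line_graph (cross p)
    & forall k, marked_points p k -> marked_points q1 k].
  move=> [pq1 [z [w sl]] mk] [[pq0 iso0] gE lg gl mk0].
  have [s0 s1] := (cross_sym pq0, cross_sym pq1).
  have [i0 i1] := (@cross_irr _ q0, @cross_irr _ q1).
  split.
  - by split=> //; exact: no_isolated_slide sl iso0.
  - by rewrite -gE; exact: gauss_slide sl.
  - by move/lg; exact: line_graph_slide sl.
  - by move/(line_graph_slide s1 i1 s0 (slide_sym s0 i0 s1 sl))/gl.
  - by move=> k /mk0/mk.
elim=> [|q0 e _ IH|q0 e _ IH]; first by split.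
  by apply: step (IH); apply: good_rauzy => //; case: IH => -[].
by apply: step (IH); apply: good_lrauzy => //; case: IH => -[].
Qed.
End Symmetries.

(** * Piece-wise order reversing pairs *)

Section Blocks.
Variable A : finType.
Local Notation n := #|A|.
Implicit Types (p : pairT A) (f g : {ffun A -> nat}).

Definition is_block p u v := forall b,
  (u <= p.1 b < v) = (u <= p.2 b < v) /\ (u <= p.1 b < v -> p.1 b + p.2 b = u + v - 1).

(** Recursive form of [pwor_witness] with cut points [k :: l], suited to induction from the left. *)
Fixpoint blocks p k (l : seq nat) : Prop :=
  if l is v :: l' then [/\ k < v, is_block p k v & blocks p v l'] else True.

Definition sizes (k : nat) (l : seq nat) := pairmap (fun u v => v - u) k l.

Lemma block_sizesE k l : block_sizes (k :: l) = sizes k l.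
Proof.
rewrite /block_sizes /=; elim: l k => //= v l IH k.
congr (_ :: _); rewrite -IH -[1]addn0 iotaDl -map_comp.
by apply: eq_map.
Qed.

Lemma witness_blocks p ks : pwor_witness p ks -> exists l,
  [/\ ks = 2 :: l, last 2 l = n, blocks p 2 l & block_sizes ks = sizes 2 l].
Proof.
case: ks => [|k l] [] //= _ -> lst srt H; exists l; split=> //; last exact: block_sizesE.
move: {lst} 2 srt H => {}k; elim: l k => //= v l IH k /andP[kv srt] H.
split=> //; first by move=> b; have := H 0 isT b.
by apply: IH => // i il b; apply: (H i.+1).
Qed.

Lemma blocks_le p k l : blocks p k l -> k <= last k l.
Proof. by elim: l k => //= v l IH k [kv _ /IH]; lia. Qed.

Lemma blocks_range p k l x : blocks p k l ->
  k <= p.1 x < last k l -> k <= p.2 x < last k l.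
Proof.
elim: l k => [|v l IH] k /=; first by lia.
move=> [kv bkv bl]; have := blocks_le bl => vn.
have [E _] := bkv x; case: (ltnP (p.1 x) v) => xv; first by move: E; lia.
by move=> ?; have := IH v bl; lia.
Qed.

Lemma sizes_big p k l : blocks p k l -> 0 < count (fun x => 2 <= x) (sizes k l) ->
  exists u v, [/\ k <= u, u.+2 <= v, v <= last k l & is_block p u v].
Proof.
elim: l k => //= v l IH k [kv bkv bl] H; have vl := blocks_le bl.
case: (leqP 2 (v - k)) => vk; first by exists k, v; split=> //; lia.
have [|u [v' [? ? ? ?]]] := IH v bl; first by lia.
by exists u, v'; split=> //; lia.
Qed.

Lemma sizes_two_big p k l : blocks p k l -> 1 < count (fun x => 2 <= x) (sizes k l) ->
  exists u v u' v', [/\ k <= u, u.+2 <= v <= u', u'.+2 <= v', v' <= last k l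
    & is_block p u v /\ is_block p u' v'].
Proof.
elim: l k => //= v l IH k [kv bkv bl] H; have vl := blocks_le bl.
case: (leqP 2 (v - k)) => vk.
  have [|u [v' [? ? ? ?]]] := sizes_big bl; first by lia.
  by exists k, v, u, v'; split=> //; lia.
have [|u [v' [u' [v'' [? ? ? ? ?]]]]] := IH v bl; first by lia.
by exists u, v', u', v''; split=> //; lia.
Qed.

Lemma sizes_ones p k l : blocks p k l -> count (fun x => x != 1) (sizes k l) = 0 ->
  forall x, k <= p.1 x < last k l -> p.1 x = p.2 x.
Proof.
elim: l k => [|v l IH] k /=; first by lia.
move=> [kv bkv bl] /eqP; rewrite addn_eq0 => /andP[H /eqP H'] x.
have [E1 E2] := bkv x.
case: (ltnP (p.1 x) v) => xv; last by move=> ?; apply: (IH v bl H'); lia.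
by move: E1 E2; lia.
Qed.

(** This is the shape of a Type 1 pair: the rows agree except on one reversed interval, which is
    empty ([U = V]) when all blocks are 1-blocks. *)
Lemma sizes_one_big p k l : blocks p k l -> count (fun x => x != 1) (sizes k l) <= 1 ->
  exists U V, [/\ k <= U, U <= V, V <= last k l & forall x, k <= p.1 x < last k l ->
    if U <= p.1 x < V then (U <= p.2 x < V) /\ p.1 x + p.2 x = U + V - 1
    else p.1 x = p.2 x].
Proof.
elim: l k => [|v l IH] k /=; first by exists k, k; split=> // x; lia.
move=> [kv bkv bl] H; have vl := blocks_le bl.
case: (eqVneq (v - k) 1) => vk; last first.
  exists k, v; split=> // [|x xl]; first lia.
  have [E1 E2] := bkv x; case: ifP => xv; first by split; [rewrite -E1|exact: E2].
  move: H; rewrite vk add1n ltnS leqn0 => /eqP H.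
  by apply: (sizes_ones bl H); lia.
have [|U [V [kU UV Vl HUV]]] := IH v bl; first by move: H; rewrite vk.
exists U, V; split=> // [|x xl]; first lia.
case: (ltnP (p.1 x) v) => xv; last by apply: HUV; lia.
have [E1 E2] := bkv x; case: ifP => xU; first by lia.
by move: E1 E2; lia.
Qed.

Lemma card_range f u v : is_pos_bij f -> 1 <= u <= v -> v <= n.+1 ->
  #|[set x | u <= f x < v]| = v - u.
Proof.
move=> Hf uv vn; have [jf _] := Hf.
rewrite cardE -(size_map f) -(size_iota u (v - u)).
apply/perm_size/uniq_perm; rewrite ?iota_uniq ?map_inj_uniq ?enum_uniq //.
move=> t; rewrite mem_iota; apply/mapP/idP => [[x]|tuv].
  by rewrite mem_enum inE => ? ->; lia.
have [|x fx] := @pos_surj _ f t Hf; first by lia.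
by exists x; rewrite // mem_enum inE fx; lia.
Qed.

Lemma standard_ends p : is_pair p -> standard p -> 2 <= n -> exists a z,
  [/\ p.1 a = 1, p.2 a = n, p.2 z = 1 & p.1 z = n].
Proof.
move=> [H0 H1] st n2.
have [|a pa] := @pos_surj _ p.1 1 H0; first by lia.
have [|z pz] := @pos_surj _ p.2 1 H1; first by lia.
exists a, z; split=> //.
  by have [E _] := st a; move: E; rewrite pa eqxx => /esym/eqP.
by have [_ E] := st z; move: E; rewrite pz eqxx => /esym/eqP.
Qed.

(** These are the empty chains other than the first and the last one. *)
Fixpoint adjacent_ones (s : seq nat) : nat :=
  if s is x :: s' then ((x == 1) && (head 0 s' == 1)) + adjacent_ones s' else 0.

Lemma last_block p k l : blocks p k l -> l != [::] ->
  exists u, [/\ k <= u, u < last k l, is_block p u (last k l)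
              & last 0 (sizes k l) = last k l - u].
Proof.
elim: l k => // v [|v' l] IH k [kv bkv bl] _; first by exists k.
have [//|u [vu ul bu E]] := IH v bl.
by exists u; split=> //; lia.
Qed.

(** * Invariants of a standard piece-wise order reversing pair *)

Section Standard.
Variables (p : pairT A) (a z : A).
Hypotheses (pp : is_pair p) (n2 : 2 <= n).
Hypotheses (fa : p.1 a = 1) (ga : p.2 a = n) (gz : p.2 z = 1) (fz : p.1 z = n).
Local Notation f := p.1.
Local Notation g := p.2.

Let az : a != z.
Proof. by apply/eqP => E; move: fz; rewrite -E fa; lia. Qed.

Let middle x : x != a -> x != z -> 2 <= f x < n /\ 2 <= g x < n.
Proof.
move=> xa xz; have [[jf bf] [jg bg]] := pp.
have := bf x; have := bg x.
have : f x != f a by rewrite (inj_eq jf).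
have : f x != f z by rewrite (inj_eq jf).
have : g x != g a by rewrite (inj_eq jg).
have : g x != g z by rewrite (inj_eq jg).
by rewrite fa fz ga gz; lia.
Qed.

Lemma cross_first x : x != a -> cross p a x.
Proof.
move=> xa; have [[jf bf] [jg bg]] := pp; rewrite /cross.
have : f x != f a by rewrite (inj_eq jf).
have : g x != g a by rewrite (inj_eq jg).
by rewrite fa ga; have := bf x; have := bg x; lia.
Qed.

Lemma cross_last x : x != z -> cross p z x.
Proof.
move=> xa; have [[jf bf] [jg bg]] := pp; rewrite /cross.
have : f x != f z by rewrite (inj_eq jf).
have : g x != g z by rewrite (inj_eq jg).
by rewrite fz gz; have := bf x; have := bg x; lia.
Qed.

Lemma standard_no_isolated : no_isolated (cross p).
Proof.
move=> x; case: (eqVneq x a) => [->|xa]; first by exists z; rewrite // cross_first 1?eq_sym.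
by exists a; rewrite // cross_sym // cross_first.
Qed.

(** Letters cross inside a block and never between blocks, so the graph is a disjoint union of
    cliques. The letter values are 0 here because splitting off [a] and [z] will flip the initial
    value 1. *)
Lemma gauss_blocks k r : 1 <= k -> blocks p k r -> last k r <= n ->
  gauss (cross p) pred0 [set x | k <= f x < last k r] =
  (\prod_(s <- sizes k r) clique_gauss false s)%R.
Proof.
elim: r k => [|v r IH] k k1.
  move=> _ _; rewrite big_nil [last _ _]/=.
  have -> : [set x | k <= f x < k] = set0 by apply/setP => x; rewrite !inE; lia.
  rewrite /gauss (big_pred1 set0) => [|v]; last by rewrite subset0.
  by rewrite /wt !big_set0.
rewrite [last _ _]/= => -[kv bkv br] lr; rewrite big_cons -(IH v) //; last by lia.
have vn := blocks_le br; set e := last v r in lr vn *.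
have -> : [set x | k <= f x < e] = [set x | k <= f x < v] :|: [set x | v <= f x < e].
  by apply/setP => x; rewrite !inE; lia.
rewrite -(@card_range f k v) //; [|by case: pp|lia|lia].
have rng x := blocks_range (x := x) br; rewrite -/e in rng.
apply: gauss_clique => //.
- exact: cross_sym.
- apply/pred0P => x /=; rewrite !inE; lia.
- move=> x y; rewrite !inE => xk yk xy; rewrite /cross.
  have [_ /(_ xk) Ex] := bkv x; have [_ /(_ yk) Ey] := bkv y.
  have : f x != f y by have [[jf _] _] := pp; rewrite (inj_eq jf).
  by lia.
- move=> x y; rewrite !inE => xk yk; rewrite /cross.
  have [Ex _] := bkv x; have := rng y yk; lia.
Qed.

(** Inside a block the rows run in opposite directions, so a pair adjacent in both rows straddles a
    cut, and then both blocks have a single letter. *)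
Lemma adjacent_blocks k r : 1 <= k -> blocks p k r -> last k r <= n ->
  #|[set u : A * A | [&& k <= f u.1, f u.2 < last k r, adj f u.1 u.2 & adj g u.1 u.2]]|
  = adjacent_ones (sizes k r).
Proof.
have [Hf Hg] := pp.
elim: r k => [|v r IH] k k1.
  move=> _ _; apply/eqP; rewrite cards_eq0; apply/eqP/setP => -[y x].
  by rewrite !inE /adj /fst /snd /last; lia.
rewrite [last _ _]/= => -[kv bkv br] lr.
have vn := blocks_le br; have := IH v _ br lr.
rewrite [sizes _ _]/= [adjacent_ones (_ :: _)]/= => <-; last by lia.
clear IH; move eE : (last v r) lr vn => e lr vn.
case: (boolP (_ && _)) => [/andP[/eqP vk]|noadj].
  case: r br eE => [|v' r] //= [vv' bvv' br] eE /eqP v'v.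
  have v'n := blocks_le br; rewrite eE in v'n.
  have [|y fy] := @pos_surj _ f k Hf; first by move: lr; clear -k1 kv vn; lia.
  have [|x fx] := @pos_surj _ f v Hf; first by move: lr; clear -k1 kv vn; lia.
  have gy : g y = k by have [E1 E2] := bkv y; move: E1 E2; rewrite fy; clear -vk k1; lia.
  have gx : g x = v by have [E1 E2] := bvv' x; move: E1 E2; rewrite fx; clear -v'v; lia.
  set S' := [set u : A * A | [&& v <= f u.1, f u.2 < e, adj f u.1 u.2 & adj g u.1 u.2]].
  have yxS : (y, x) \notin S' by rewrite inE /= fy leqNgt kv.
  have -> : [set u : A * A | [&& k <= f u.1, f u.2 < e, adj f u.1 u.2 & adj g u.1 u.2]]
     = (y, x) |: S'.
    apply/setP => -[y' x']; rewrite !inE /= xpair_eqE /adj.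
    case: (ltnP (f y') v) => y'v; last first.
      have -> : (y' == y) = false by apply/eqP => E; move: y'v; rewrite E fy; clear -kv; lia.
      by rewrite /=; have -> : k <= f y' by move: y'v kv; clear; lia.
    rewrite [RHS]orbF; apply/idP/idP => [/and4P[ky' x'e /eqP fx' /eqP gx']|].
      have fy' : f y' = k by move: y'v ky' vk; clear; lia.
      have -> : y' = y by apply: (proj1 Hf); rewrite fy' fy.
      have -> : x' = x by apply: (proj1 Hf); rewrite fx' fy' fx; move: vk; clear -kv; lia.
      by rewrite !eqxx.
    by case/andP=> /eqP-> /eqP->; rewrite fx fy gx gy; move: vk v'v v'n; clear -kv; lia.
  by rewrite cardsU1 yxS.
rewrite add0n; apply: eq_card => -[y x]; rewrite !inE /=.
case: (leqP v (f y)) => vy; first by have -> : k <= f y by move: vy kv; clear; lia.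
apply/negbTE/negP => /and4P[ky xe /eqP fx /eqP gx].
have [_ E] := bkv y; have {E}Ey : f y + g y = k + v - 1 by apply: E; rewrite ky.
have [_ E] := bkv x; case: (ltnP (f x) v) => xv.
  have := E; rewrite xv andbT => E'; have : f x + g x = k + v - 1 by apply: E'; move: fx ky; clear; lia.
  by move: fx gx Ey; clear; lia.
have fxv : f x = v by move: fx xv vy; clear; lia.
case: r br eE noadj => [|v' r] /=; first by move: xe => /[swap] _ /[swap] <-; rewrite fxv ltnn.
move=> [vv' bvv' br] eE noadj.
(* Here g y = k and g x = v' - 1, so adjacency in [g] gives v' = k + 2, and both blocks are
   1-blocks. *)
have [_ E''] := bvv' x; have : f x + g x = v + v' - 1 by apply: E''; rewrite fxv leqnn.
by move: noadj Ey fx gx fxv kv vv'; clear; lia.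
Qed.

Variable l : seq nat.
Hypotheses (bl : blocks p 2 l) (lst : last 2 l = n).

(** The letters [a] and [z] cross all others and each other. As twins of value 1 they give the
    factor -2 and flip all other values to 0. *)
Lemma gauss_standard : gauss (cross p) predT setT =
  (- 2%:R * \prod_(s <- sizes 2 l) clique_gauss false s)%R.
Proof.
rewrite -(gauss_blocks _ bl) ?lst //.
have [[jf bf] [jg bg]] := pp.
have -> : [set: A] = a |: (z |: [set x | 2 <= f x < n]).
  apply/setP => x; rewrite !inE; case: (eqVneq x a) => //= xa; case: (eqVneq x z) => //= xz.
  by have [] := middle xa xz.
rewrite gauss_twins.
- rewrite (@eq_gauss _ _ _ pred0) => [|x]; first by rewrite /sgn expr1 mulrN1.
  rewrite inE => xm; rewrite cross_first //.
  by apply/eqP => E; move: xm; rewrite E fa.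
- exact: cross_sym.
- by rewrite !inE (negbTE az) fa.
- by rewrite !inE fz; lia.
- by rewrite cross_first // eq_sym.
- by [].
move=> x; rewrite inE => xm; rewrite cross_first ?cross_last //.
  by apply/eqP => E; move: xm; rewrite E fz; lia.
by apply/eqP => E; move: xm; rewrite E fa; lia.
Qed.

(** The two end letters and the big block form a clique, realized by the sets {None, x}. Every other
    letter crosses only [a] and [z] and is sent to {a, z}. *)
Lemma standard_line_graph : count (fun x => x != 1) (sizes 2 l) <= 1 ->
  line_graph (cross p).
Proof.
move=> /(sizes_one_big bl)[U [V [U2 UV]]]; rewrite lst => Vn HUV.
pose K x := [|| x == a, x == z | U <= f x < V].
exists (fun x => if K x then [set None; Some x] else [set Some a; Some z]); split.
  by move=> x; case: ifP => _; rewrite cards2 // (inj_eq Some_inj) az.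
have neq x y : x != y -> f x != f y by have [[jf _] _] := pp; rewrite (inj_eq jf).
have outK x : K x = false -> [/\ 2 <= f x < n, (U <= f x < V) = false & f x = g x].
  move/negbT; rewrite !negb_or => /and3P[xa xz /negbTE xUV].
  by have [fx _] := middle xa xz; have := HUV x fx; rewrite xUV.
have inK x : K x -> x != a -> x != z -> U <= f x < V /\ (U <= g x < V) /\ f x + g x = U + V - 1.
  move=> Kx xa xz; have [fx _] := middle xa xz; have := HUV x fx.
  by move: Kx; rewrite /K (negbTE xa) (negbTE xz) /= => ->.
have KN x y : K x -> K y = false ->
    cross p x y = odd #|[set None; Some x] :&: [set Some a; Some z]|.
  move=> Kx Ky; have [fy yUV fgy] := outK y Ky.
  have [ya yz] : y != a /\ y != z.
    by move/negbT: Ky; rewrite !negb_or => /and3P[].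
  rewrite odd_cardI2 ?(inj_eq Some_inj) // !inE /= !(inj_eq Some_inj).
  case: (eqVneq a x) => [<-|ax]; first by rewrite cross_first // eq_sym (negbTE az).
  case: (eqVneq z x) => [<-|zx]; first by rewrite cross_last.
  have [] := inK x Kx; rewrite 1?eq_sym // => ? [? ?].
  by rewrite /cross; lia.
move=> x y xy; case: (boolP (K x)) => [Kx|/negbTE Kx]; case: (boolP (K y)) => [Ky|/negbTE Ky].
- rewrite odd_cardI2 // !inE /= (inj_eq Some_inj) [y == x]eq_sym (negbTE xy) /=.
  case: (eqVneq x a) xy => [-> ay|xa xy]; first by rewrite cross_first // eq_sym.
  case: (eqVneq x z) xy => [-> zy|xz xy]; first by rewrite cross_last // eq_sym.
  case: (eqVneq y a) => [->|ya]; first by rewrite cross_sym // cross_first.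
  case: (eqVneq y z) => [->|yz]; first by rewrite cross_sym // cross_last.
  have [? [? ?]] := inK x Kx xa xz; have [? [? ?]] := inK y Ky ya yz.
  by rewrite /cross; have := neq _ _ xy; lia.
- exact: KN.
- by rewrite cross_sym // KN // setIC.
- rewrite setIid cards2 (inj_eq Some_inj) az /=; have [_ _ Ex] := outK x Kx; have [_ _ Ey] := outK y Ky.
  by rewrite /cross -Ex -Ey addbb.
Qed.

(** Two letters from each of two big blocks, together with [a] and [z], form the configuration
    excluded by [no_two_stars]. *)
Lemma standard_not_line_graph : 1 < count (fun x => 2 <= x) (sizes 2 l) ->
  ~ line_graph (cross p).
Proof.
move=> /(sizes_two_big bl)[u [v [u' [v' []]]]]; rewrite lst => u2 uv uv' vn [b1 b2].
move=> [phi [cphi phiE]]; have [Hf Hg] := pp.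
have [|b fb] := @pos_surj _ f u Hf; first by lia.
have [|c fc] := @pos_surj _ f u.+1 Hf; first by lia.
have [|d fd] := @pos_surj _ f u' Hf; first by lia.
have [|e fe] := @pos_surj _ f u'.+1 Hf; first by lia.
have gb : g b = v.-1 by have [_ E] := b1 b; move: E; rewrite fb; lia.
have gc : g c = v.-2 by have [_ E] := b1 c; move: E; rewrite fc; lia.
have gd : g d = v'.-1 by have [_ E] := b2 d; move: E; rewrite fd; lia.
have ge : g e = v'.-2 by have [_ E] := b2 e; move: E; rewrite fe; lia.
have fne x y : f x != f y -> x != y by apply: contra => /eqP->.
have ne x : 2 <= f x < n -> x != a /\ x != z.
  by move=> fx; split; apply: fne; move: fx; rewrite ?fa ?fz; clear; lia.
have [|ba bz] := ne b; first lia.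
have [|ca cz] := ne c; first lia.
have [|da dz] := ne d; first lia.
have [|ea ez] := ne e; first lia.
have symp := cross_sym pp.
have ca' x : x != a -> odd #|phi x :&: phi a| by move=> xa; rewrite -phiE // symp cross_first.
have cz' x : x != z -> odd #|phi x :&: phi z| by move=> xz; rewrite -phiE // symp cross_last.
apply: (@no_two_stars _ (phi a) (phi z) (phi b) (phi c) (phi d) (phi e)); rewrite ?cphi ?ca' ?cz' //.
- rewrite -phiE; last by apply: fne; lia.
  by rewrite /cross; lia.
- rewrite -phiE; last by apply: fne; lia.
  by rewrite /cross; lia.
- rewrite -phiE; last by apply: fne; lia.
  by rewrite /cross; lia.
- rewrite -phiE; last by apply: fne; lia.
  by rewrite /cross; lia.
Qed.
(** The second summand of [marked] asks for a letter at position 2 in both rows, the third for one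
    at position n - 1: the first or last block is a 1-block. The fourth would need n = 2. *)
Lemma standard_marked : 3 <= n -> marked f g z a a z =
  (head 0 (sizes 2 l) == 1) + adjacent_ones (sizes 2 l) + (last 0 (sizes 2 l) == 1).
Proof.
move=> n3; have [Hf Hg] := pp; have [[jf bf] [jg bg]] := pp.
have lne : l != [::] by apply/eqP => E; move: lst; rewrite E [last _ _]/=; move: n3; clear; lia.
rewrite -(adjacent_blocks _ bl) ?lst // /marked.
have -> : adj g z a = false by rewrite /adj gz ga; lia.
rewrite addn0; congr (_ + _).
  rewrite addnC; congr (_ + _).
    case: l lne bl lst => // v r _ [v2 bv br] lr; congr nat_of_bool.
    rewrite [head _ _]/=; apply/existsP/idP => [[x]|v3].
      rewrite /adj gz fa => /andP[/eqP gx /eqP fx]; have [_ E] := bv x; move: E.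
      by rewrite fx gx; move: v2; clear; lia.
    have [|x fx] := @pos_surj _ f 2 Hf; first by lia.
    exists x; rewrite /adj gz fa fx eqxx andbT; have [E1 E2] := bv x; move: E1 E2.
    by rewrite fx; move: v3; clear; lia.
  apply: eq_card => -[y x]; rewrite !inE.
  change (adj f y x && adj g y x = [&& 2 <= f y, f x < n, adj f y x & adj g y x]).
  apply/idP/and4P => [/andP[/eqP fx /eqP gx]|[_ _ -> ->]] //.
  split; try exact/eqP.
    case: (eqVneq y a) => [E|ya]; first by move: gx; rewrite E ga; have := bg x; lia.
    have : f y != f a by rewrite (inj_eq jf).
    by rewrite fa; have := bf y; lia.
  case: (eqVneq x z) => [E|xz]; first by move: gx; rewrite E gz; have := bg y; lia.
  have : f x != f z by rewrite (inj_eq jf).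
  by rewrite fz; have := bf x; lia.
have [u []] := last_block bl lne; rewrite lst => u2 un bu ->; congr nat_of_bool.
apply/existsP/idP => [[y]|nu].
  rewrite /adj ga fz => /andP[/eqP gy /eqP fy]; have [_ E] := bu y; move: E.
  by lia.
have [|y fy] := @pos_surj _ f u Hf; first by lia.
exists y; rewrite /adj ga fz; have [E1 E2] := bu y; move: E1 E2; rewrite fy.
by lia.
Qed.
End Standard.
End Blocks.

(** * Chains and types *)

Section Chains.
Implicit Types (s c : seq nat) (cs : seq (seq nat)).

Lemma chains_cons s : exists c cs, chains s = c :: cs.
Proof.
case: s => [|x s] /=; first by exists [::], [::].
case: ifP => _; first by exists [::], (chains s).
by case: (chains s) => [|c cs]; [exists [:: x], [::] | exists (x :: c), cs].
Qed.

Lemma size_chains s : size (chains s) = (count_mem 1 s).+1.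
Proof.
elim: s => //= x s IH; have [c [cs E]] := chains_cons s.
by rewrite E in IH *; case: (eqVneq x 1) => _ /=; rewrite ?add1n ?add0n -IH.
Qed.

Lemma flatten_chains s : flatten (chains s) = [seq x <- s | x != 1].
Proof.
elim: s => //= x s IH; have [c [cs E]] := chains_cons s.
by case: (eqVneq x 1) => _ //=; rewrite E in IH *; rewrite -IH.
Qed.

(** The default 1 matters: the empty list has an empty first chain. *)
Lemma chains_head s : (head [::] (chains s) == [::]) = (head 1 s == 1).
Proof.
case: s => //= x s; case: ifP => // _.
by have [c [cs ->]] := chains_cons s.
Qed.

(** The right-hand side is the count of [standard_marked]; its summands are the first, the inner and
    the last empty chains. *)
Lemma count_empty_chains s : s != [::] ->
  count_mem [::] (chains s) = (head 0 s == 1) + adjacent_ones s + (last 0 s == 1).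
Proof.
elim: s => // x [|y s] IH _; first by rewrite /=; case: (eqVneq x 1).
have := IH isT; have := chains_head (y :: s).
have [c [cs E]] := chains_cons (y :: s).
have -> : chains (x :: y :: s) = if x == 1 then [::] :: c :: cs else (x :: c) :: cs.
  by rewrite -E [LHS]/= -/(chains (y :: s)) E.
have -> : adjacent_ones (x :: y :: s) = ((x == 1) && (y == 1)) + adjacent_ones (y :: s) by [].
have -> : last 0 (x :: y :: s) = last 0 (y :: s) by [].
rewrite E; move: (adjacent_ones _) (last _ _) => m t.
rewrite [head _ (_ :: _)]/= [head 1 _]/= [head 0 _]/= [head 0 (x :: _)]/= => cE H.
by move: H cE; case: (eqVneq x 1) => _ /=; lia.
Qed.

Lemma size_nonempty_chains cs : size (nonempty_chains cs) + count_mem [::] cs = size cs.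
Proof.
rewrite size_filter -(count_predC (pred1 [::]) cs) addnC; congr (_ + _).
Qed.

Lemma size_nonempty_le cs : size (nonempty_chains cs) <= size (flatten cs).
Proof.
elim: cs => //= c cs IH; rewrite size_cat /nonempty_chains /=.
by case: c => [|x c] //=; rewrite ltnS (leq_trans IH) // leq_addl.
Qed.

Lemma size_nonempty_eq cs : all (fun c => size c <= 1) cs ->
  size (nonempty_chains cs) = size (flatten cs).
Proof.
elim: cs => //= c cs IH /andP[c1 /IH]; rewrite size_cat /nonempty_chains /= => <-.
by case: c c1 => [|x [|]].
Qed.

Lemma nth_split_all cs i (P : pred (seq nat)) : i < size cs ->
  (forall j, j < size cs -> j <> i -> P (nth [::] cs j)) ->
  exists c1 c2 : seq (seq nat), [/\ cs = c1 ++ nth [::] cs i :: c2, all P c1 & all P c2].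
Proof.
elim: cs i => // c cs IH [|i] /= il H.
  exists [::], cs; split=> //; apply/(all_nthP [::]) => j jl.
  by apply: (H j.+1).
have [j jl ji|c1 [c2 [E P1 P2]]] := IH i il; first by apply: (H j.+1) => // -[].
exists (c :: c1), c2; split=> //=; first by rewrite {1}E.
by rewrite P1 (H 0).
Qed.

Lemma mem_chains s x : x \in s -> x != 1 ->
  exists2 c, c \in nonempty_chains (chains s) & x \in c.
Proof.
move=> xs x1; have : x \in flatten (chains s) by rewrite flatten_chains mem_filter x1.
by move=> /flattenP[c cC xc]; exists c => //; rewrite mem_filter cC andbT; case: c xc {cC}.
Qed.

Lemma nonempty_mem s c x : c \in nonempty_chains (chains s) -> x \in c -> x \in s.
Proof.
rewrite mem_filter => /andP[_ cC] xc.
have : x \in flatten (chains s) by apply/flattenP; exists c.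
by rewrite flatten_chains mem_filter => /andP[].
Qed.

Lemma type1_sizes s : type_cond 1 s -> count (fun x => x != 1) s <= 1.
Proof.
move=> [ne1 sz]; rewrite -size_filter -flatten_chains.
have -> : flatten (chains s) = flatten (nonempty_chains (chains s)).
  by elim: (chains s) => //= c cs IH; case: c => [|x c] //=; rewrite IH.
move: ne1 sz; case: (nonempty_chains _) => [|c [|]] //= _ /(_ c).
by rewrite inE eqxx cats0 => ->.
Qed.

(** Data of a list with entries 1, 2 and [K] in terms of multiplicities. Sizes 1 and 2 both
    contribute the factor 2 to the product. *)
Definition mult_stats K s :=
  [/\ (\prod_(x <- s) clique_gauss false x =
        2 ^+ (count_mem 1%N s + count_mem 2%N s) * clique_gauss false K ^+ count_mem K s)%R,
      sumn s = count_mem 1 s + 2 * count_mem 2 s + K * count_mem K s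
    & count (fun x : nat => x != 1) s = count_mem 2 s + count_mem K s].

Lemma mult_statsP K s : 2 < K -> all (fun x => [|| x == 1, x == 2 | x == K]) s ->
  mult_stats K s.
Proof.
move=> K2; have [K1' K2'] : (K == 1) = false /\ (K == 2) = false by lia.
elim: s => [_|x s IH /= /andP[xK /IH[E1 E2 E3]]].
  by split=> //=; [rewrite big_nil !expr0 mulr1 | rewrite !muln0].
rewrite /mult_stats big_cons E1 /= E2 E3; case/or3P: xK => /eqP->.
- rewrite ?[_ == K]eq_sym ?K1' ?K2' /=; split; [|lia|lia].
  by rewrite add0n add1n addSn exprS mulrA.
- rewrite ?[_ == K]eq_sym ?K1' ?K2' /=; split; [|lia|lia].
  by rewrite add0n add1n addnS exprS mulrA mulr1.
- rewrite eqxx ?K1' ?K2' /= !add0n add1n; split; [|lia|lia].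
  by rewrite exprS; ring.
Qed.

Lemma type2_prod s : type_cond 2 s -> (0 < \prod_(x <- s) clique_gauss false x)%R.
Proof.
move=> [_ H].
have H12 : all (fun x => (x == 1) || (x == 2)) s.
  apply/allP => x xs; case: (eqVneq x 1) => //= x1.
  have [c cC xc] := mem_chains xs x1.
  by have /allP/(_ x xc) := H c cC.
rewrite big_seq; apply: prodr_gt0 => x /(allP H12) /orP[]/eqP->//.
Qed.

Lemma type3_prod s : type_cond 3 s -> (\prod_(x <- s) clique_gauss false x = 0)%R.
Proof.
move=> [_ [_ [c cC [m [r cE]]]]].
have s3 : 3 \in s.
  by apply: (nonempty_mem cC); rewrite cE mem_cat inE eqxx orbT.
by rewrite (big_rem 3 s3) /= mulr0 mul0r.
Qed.

Lemma one_big_chain K s (c1 c2 : seq (seq nat)) m : 2 < K ->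
  chains s = c1 ++ (K :: nseq m 2) :: c2 ->
  all (all (fun y => y == 2)) c1 -> all (all (fun y => y == 2)) c2 ->
  mult_stats K s /\ count_mem K s = 1.
Proof.
move=> K2 E A1 A2; have FE := flatten_chains s.
have F2 cs : all (all (fun y => y == 2)) cs -> all (fun y => y == 2) (flatten cs).
  by elim: cs => //= c cs IH /andP[? /IH]; rewrite all_cat => ->; rewrite andbT.
have C0 r : all (fun y => y == 2) r -> count_mem K r = 0.
  move=> r2; apply/count_memPn/negP => /(allP r2) /eqP; lia.
have n2 : all (fun y => y == 2) (nseq m 2) by rewrite all_nseq eqxx orbT.
split.
  apply: mult_statsP => //; apply/allP => x xs; case: (eqVneq x 1) => //= x1.
  have : x \in flatten (chains s) by rewrite FE mem_filter x1.
  rewrite E flatten_cat /= mem_cat in_cons mem_cat.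
  case/or4P=> [/(allP (F2 _ A1)) ->|->|/(allP n2) ->|/(allP (F2 _ A2)) ->] //.
  by rewrite orbT.
have -> : count_mem K s = count_mem K (flatten (chains s)).
  rewrite FE count_filter; apply: eq_count => x /=; case: (eqVneq x K) => //= ->; lia.
by rewrite E flatten_cat /= count_cat /= count_cat !C0 ?F2 // eqxx.
Qed.

(** With i 1-blocks and j 2-blocks there are i + 1 chains, of which at most j + 1 are nonempty, one
    for each big block. *)
Lemma type4_stats s : type_cond 4 s -> exists i j,
  [/\ (\prod_(x <- s) clique_gauss false x = - 4%:R * 2 ^+ (i + j))%R,
      sumn s = i + 2 * j + 4 & i <= count_mem [::] (chains s) + j].
Proof.
move=> [_ [i [il [m cE] H]]].
have [c1 [c2 [E A1 A2]]] := nth_split_all il H; rewrite cE in E.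
have [[E1 E2 E3] K1] := @one_big_chain 4 _ _ _ _ isT E A1 A2; rewrite K1 in E1 E2 E3.
exists (count_mem 1 s), (count_mem 2 s); split.
- by rewrite E1 mulrC.
- by rewrite E2.
have := size_nonempty_le (chains s); have := size_nonempty_chains (chains s).
by rewrite size_chains flatten_chains (size_filter _ s) E3; lia.
Qed.

Lemma type5_stats s : type_cond 5 s -> exists i j,
  [/\ (\prod_(x <- s) clique_gauss false x = - 8%:R * 2 ^+ (i + j))%R,
      sumn s = i + 2 * j + 5 & i = count_mem [::] (chains s) + j].
Proof.
move=> [_ [i [il cE H]]].
pose P c := (c == [::]) || (c == [:: 2]).
have [j jl ji|c1 [c2 [E A1 A2]]] := @nth_split_all _ _ P il.
  by rewrite /P; case: (H j jl ji) => ->.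
rewrite cE in E.
have P2 c : P c -> all (fun y => y == 2) c by case/orP=> /eqP->.
have [[E1 E2 E3] K1] := @one_big_chain 5 s c1 c2 0 isT E (sub_all P2 A1) (sub_all P2 A2).
rewrite K1 in E1 E2 E3.
exists (count_mem 1 s), (count_mem 2 s); split.
- by rewrite E1 mulrC.
- by rewrite E2.
have P1 c : P c -> size c <= 1 by case/orP=> /eqP->.
have A : all (fun c => size c <= 1) (chains s).
  by rewrite E all_cat /= (sub_all P1 A1) (sub_all P1 A2).
have := size_nonempty_eq A; have := size_nonempty_chains (chains s).
by rewrite size_chains flatten_chains (size_filter _ s) E3; lia.
Qed.

Lemma type_many x s : type_cond x s -> x != 1 -> 1 < count (fun y => 2 <= y) s.
Proof. by case: x => [|[|[|[|[|[|]]]]]] //= [mb _]. Qed.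
End Chains.

(** * Separation of the types by the invariants *)

Section Classification.
Variable A : finType.
Local Notation n := #|A|.
Implicit Types p q : pairT A.

Lemma sumn_sizes p k l : blocks p k l -> sumn (sizes k l) + k = last k l.
Proof. by elim: l k => //= v l IH k [kv _ /IH]; lia. Qed.

Lemma marked_points_unique p k k' : is_pair p ->
  marked_points p k -> marked_points p k' -> k = k'.
Proof.
move=> [[jf _] [jg _]] [l [l' [a [a' [fl gl' fa ga' <-]]]]].
move=> [m [m' [b [b' [fm gm' fb gb' <-]]]]].
by rewrite (jf m l) ?fm // (jg m' l') ?gm' // (jf b a) ?fb // (jg b' a') ?gb'.
Qed.

Lemma has_type_data x p : 2 <= n -> is_pair p -> has_type x p ->
  no_isolated (cross p) /\ exists s,
  [/\ type_cond x s,
      sumn s + 2 = n,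
      gauss (cross p) predT setT = (- 2%:R * \prod_(k <- s) clique_gauss false k)%R,
      x = 1 <-> line_graph (cross p)
    & x != 1 -> marked_points p (count_mem [::] (chains s))].
Proof.
move=> n2 pp [st [ks [/witness_blocks[l [-> lst bl ->]] tc]]].
have [a [z [fa ga gz fz]]] := standard_ends pp st n2.
split; first exact: standard_no_isolated pp n2 fa ga gz fz.
exists (sizes 2 l); split=> //.
- by rewrite (sumn_sizes bl).
- by rewrite (gauss_standard pp n2 fa ga gz fz bl lst).
- split=> [x1|lg].
    rewrite x1 in tc; apply: (standard_line_graph pp n2 fa ga gz fz bl lst).
    exact: type1_sizes.
  apply/eqP; case: (eqVneq x 1) => // x1; exfalso.
  exact: (standard_not_line_graph pp n2 fa ga gz fz bl lst (type_many tc x1)).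
(* Two big blocks provide the bound [3 <= n] that [standard_marked] requires. *)
move=> x1; have many := type_many tc x1.
have lne : l != [::] by apply: contraTneq many => ->.
have n3 : 3 <= n by rewrite -lst; case: l bl lne {lst tc many} => //= v l [v2 _ /blocks_le]; lia.
exists z, a, a, z; split=> //.
rewrite (standard_marked pp n2 fa ga gz fz bl lst n3) count_empty_chains //.
by case: l lne {bl lst tc many}.
Qed.
End Classification.

Theorem theorem4p7 (A : finType) (x y : nat) (p q : pairT A) :
  2 <= #|A| -> is_pair p -> irreducible p ->
  has_type x p -> ext_class p q -> has_type y q -> x = y.
Proof.
move=> n2 pp _ tx pq ty.
have [isop [s [tcx sn gs x1 mx]]] := has_type_data n2 pp tx.
have n0 : 0 < #|A| by lia.
have [[pq' _] gE lg gl mk] := ext_class_invariants pp isop n0 pq.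
have [_ [t [tcy tn gt y1 my]]] := has_type_data n2 pq' ty.
have x1y1 : x = 1 <-> y = 1.
  by split=> [/x1/lg/y1|/y1/gl/x1].
case: (eqVneq x 1) => [xE|xn]; first by rewrite xE (x1y1.1 xE).
have yn : y != 1 by apply: contra xn => /eqP/x1y1.2->.
have cE := marked_points_unique pq' (mk _ (mx xn)) (my yn).
have PE : (\prod_(k <- s) clique_gauss false k = \prod_(k <- t) clique_gauss false k)%R.
  by move: gE; rewrite gs gt => /(mulfI _) -> //; rewrite oppr_eq0.
have stn : sumn s = sumn t by apply/eqP; rewrite -(eqn_add2r 2) sn tn.
have cls u r : type_cond u r -> u != 1 ->
    [\/ u = 2 /\ (0 < \prod_(k <- r) clique_gauss false k)%R,
        u = 3 /\ (\prod_(k <- r) clique_gauss false k = 0)%R,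
        u = 4 /\ (\prod_(k <- r) clique_gauss false k < 0)%R
      | u = 5 /\ (\prod_(k <- r) clique_gauss false k < 0)%R].
  have neg (m : int) j : (0 < m -> - m * 2 ^+ j < 0)%R.
    by move=> m0; rewrite mulNr oppr_lt0 mulr_gt0 // exprn_gt0.
  case: u => [|[|[|[|[|[|u]]]]]] tc // _.
  - by apply: Or41; split=> //; exact: type2_prod.
  - by apply: Or42; split=> //; exact: type3_prod.
  - by apply: Or43; split=> //; have [i [j [-> _ _]]] := type4_stats tc; apply: neg.
  - by apply: Or44; split=> //; have [i [j [-> _ _]]] := type5_stats tc; apply: neg.
(* Equal products give i + j = i' + j' + 1 and equal sizes give i + 2j = i' + 2j' + 1, so j = j' and
   i = i' + 1. With e empty chains on both sides, i <= e + j = i', a contradiction. *)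
have no45 s1 s2 : type_cond 4 s1 -> type_cond 5 s2 -> sumn s1 = sumn s2 ->
   count_mem [::] (chains s1) = count_mem [::] (chains s2) ->
   (\prod_(k <- s1) clique_gauss false k = \prod_(k <- s2) clique_gauss false k)%R -> False.
  move=> /type4_stats[i [j [-> -> le4]]] /type5_stats[i' [j' [-> -> eq5]]] sE nE.
  have -> : (- 8%:R * 2 ^+ (i' + j') = - 4%:R * 2 ^+ (i' + j').+1 :> int)%R.
    by rewrite exprS; ring.
  move=> /(mulfI _)-/(_ isT) E; have := @ieexprIn int 2 isT isT _ _ E; lia.
(* The sign of the product settles all cases except 4 against 5. *)
case: (cls x s tcx xn) => -[xE Px]; case: (cls y t tcy yn) => -[yE Py]; rewrite xE yE //;
  rewrite xE in tcx; rewrite yE in tcy;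
  try by exfalso; move: Px Py; rewrite PE; clear; lia.
- by case: (no45 s t tcx tcy stn cE PE).
- by case: (no45 t s tcy tcx (esym stn) (esym cE) (esym PE)).
Qed.
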